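(* (1) Let $G$ be a connected graph with $n\ge 9$ vertices and cyclomatic number $5$. Then $R(G)\le \frac{1}{2}n-\frac{5-2\sqrt{6}}{6}$, with equality if and only if $G\in\Omega_1(n)$. (2) Let $G$ be a connected graph with $n\ge 11$ vertices and cyclomatic number $6$. Then $R(G)\le \frac{1}{2}n-\frac{5-2\sqrt{6}}{6}$, with equality if and only if $G\in\Omega_3(n)$.
   Context: All graphs are finite, simple and undirected. A connected graph with $n$ vertices has cyclomatic number $c$ if it has $n+c-1$ edges. The Randić index is $R(G)=\sum_{uv\in E(G)}\frac{1}{\sqrt{\deg_G(u)\deg_G(v)}}$. $n_i(G)$ is the number of vertices of degree $i$ and $m_{i,j}(G)$ the number of edges joining a vertex of degree $i$ to a vertex of degree $j$. $\Omega_1(n)$ is the set of $n$-vertex graphs $G$ with $n_3(G)=8$, $n_2(G)=n-8$ (so all vertices have degree 2 or 3), $m_{3,3}(G)=11$, $m_{2,3}(G)=2$, $m_{2,2}(G)=n-9$. $\Omega_3(n)$ is the set of $n$-vertex graphs $G$ with $n_3(G)=10$, $n_2(G)=n-10$, $m_{3,3}(G)=14$, $m_{2,3}(G)=2$, $m_{2,2}(G)=n-11$. *)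

(* Defs.v *)
From HB Require Import structures.
From mathcomp Require Import all_boot all_order all_algebra.
From mathcomp Require Import reals.

Set Implicit Arguments.
Unset Strict Implicit.
Unset Printing Implicit Defensive.

Import Order.TTheory GRing.Theory Num.Theory.
Local Open Scope ring_scope.

Record sgraph := SGraph {
  vertex :> finType;
  adj : rel vertex;
  adj_sym : symmetric adj;
  adj_irrefl : irreflexive adj }.

(* Undirected edges are the two-element sets of adjacent vertices, so that
   each edge is counted once. *)
Definition edges (G : sgraph) : {set {set G}} :=
  [set [set p.1; p.2] | p : G * G & adj p.1 p.2].

Definition deg (G : sgraph) (v : G) : nat := #|[set w | adj v w]|.

Definition connected (G : sgraph) : Prop :=
  (0 < #|vertex G|)%N /\ forall u v : G, connect (@adj G) u v.

Definition has_cyclomatic_number (G : sgraph) (c : nat) : Prop :=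
  connected G /\ #|edges G| = (#|vertex G| + c - 1)%N.

(* For an edge A = {u, v} the product is deg u * deg v. *)
Definition randic (R : realType) (G : sgraph) : R :=
  \sum_(A in edges G) 1 / Num.sqrt (\prod_(v in A) (deg v)%:R).

Definition n_deg (G : sgraph) (i : nat) : nat := #|[set v : G | deg v == i]|.

Definition m_deg (G : sgraph) (i j : nat) : nat :=
  #|[set A in edges G |
      [exists u : G, exists v : G,
        [&& A == [set u; v], deg u == i & deg v == j]]]|.

(* In Omega1 and Omega3 the equations n_2 = n - a and m_{2,2} = n - b are
   written additively, to avoid truncated subtraction. *)
Definition Omega1 (n : nat) : {pred sgraph} :=
  [pred G : sgraph | [&& #|vertex G| == n, n_deg G 3 == 8%N,
                (n_deg G 2 + 8 == n)%N, m_deg G 3 3 == 11%N,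
                m_deg G 2 3 == 2%N & (m_deg G 2 2 + 9 == n)%N]].

Definition Omega3 (n : nat) : {pred sgraph} :=
  [pred G : sgraph | [&& #|vertex G| == n, n_deg G 3 == 10%N,
                (n_deg G 2 + 10 == n)%N, m_deg G 3 3 == 14%N,
                m_deg G 2 3 == 2%N & (m_deg G 2 2 + 11 == n)%N]].

(* Main.v *)
(** Without isolated vertices, [2 R(G) = n - S/2], where [S] is the sum over all
    arcs [(u, v)] of the cost [(1/sqrt(deg u) - 1/sqrt(deg v))^2].  The bound thus
    says [S >= 4 w], where [w = (5 - 2 sqrt 6)/6] is the cost of an arc joining
    degrees 2 and 3.  For cyclomatic number [c >= 2] and [n > 2(c-1)] the average
    degree lies strictly between 2 and 3.  If some vertex has degree 1, an edge
    leaving the set of such vertices alone costs more than [2 w] in each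
    direction.  Otherwise the number of edges leaving the set of degree-2 vertices
    is positive by connectivity, even by counting degrees, and each costs at least
    [w] per direction.  Equality forces exactly two such edges, with outer ends of
    degree 3, and equal degrees across all other edges, so by connectivity all
    degrees are 2 or 3; counting degrees gives the remaining parameters. *)

Require Import Defs.
From mathcomp Require Import all_boot all_order all_algebra.
From mathcomp Require Import reals.
From mathcomp Require Import zify ring lra.

Set Implicit Arguments.
Unset Strict Implicit.
Unset Printing Implicit Defensive.

Import Order.TTheory GRing.Theory Num.Theory.
Local Open Scope ring_scope.

(** * Sums and counts over arcs, the ordered pairs of adjacent vertices *)

Lemma sum_arcs (V : nmodType) (G : sgraph) (F : {set G} -> V) :
  \sum_(p : G * G | adj p.1 p.2) F [set p.1; p.2] =
  (\sum_(A in edges G) F A) *+ 2.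
Proof.
rewrite (partition_big (fun p : G * G => [set p.1; p.2]) (mem (edges G))) /=;
  last by move=> p pP; apply/imsetP; exists p; rewrite ?inE.
rewrite -sumrMnl; apply: eq_bigr => _ /imsetP[[u v] /[!inE]/= uv ->].
have neq_uv : u != v by apply: contraTneq uv => ->; rewrite adj_irrefl.
(* The fibre over an edge is a pair of opposite arcs, distinct since there are no loops. *)
rewrite (eq_bigl (mem [set (u, v); (v, u)])); last first.
  move=> [x y] /=; rewrite !inE !xpair_eqE /=.
  apply/andP/orP => [[xy /eqP/setP E]|[] /andP[/eqP-> /eqP->]]; last first.
  - by rewrite adj_sym uv setUC.
  - by rewrite uv.
  have neq_xy : x != y by apply: contraTneq xy => ->; rewrite adj_irrefl.
  move: (E u) (E v) neq_uv neq_xy; rewrite !inE !eqxx orbT /=.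
  move=> /orP[]/eqP-> /orP[]/eqP->; rewrite ?eqxx //; by [left|right].
rewrite big_setU1 /= ?inE ?xpair_eqE ?negb_and ?neq_uv // big_set1 /=.
by rewrite [[set v; u]]setUC mulr2n.
Qed.

Lemma sum_arcs_swap (V : nmodType) (G : sgraph) (P : rel G) (F : G -> G -> V) :
  \sum_(p : G * G | adj p.1 p.2 && P p.1 p.2) F p.1 p.2 =
  \sum_(p : G * G | adj p.1 p.2 && P p.2 p.1) F p.2 p.1.
Proof.
have swapK : involutive (fun p : G * G => (p.2, p.1)) by case.
rewrite (reindex_inj (inv_inj swapK)) /=.
by apply: eq_bigl => p; rewrite adj_sym.
Qed.

Lemma sum_arcs_tail (V : nmodType) (G : sgraph) (P : pred G) (F : G -> V) :
  \sum_(p : G * G | adj p.1 p.2 && P p.1) F p.1 = \sum_(u | P u) F u *+ deg u.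
Proof.
rewrite (eq_bigl (fun p : G * G => P p.1 && adj p.1 p.2));
  last by move=> p; rewrite andbC.
rewrite -(pair_big_dep P (fun u v => adj u v) (fun u _ => F u)) /=.
apply: eq_bigr => u _; rewrite sumr_const; congr (_ *+ _).
by apply: eq_card => v; rewrite !inE.
Qed.

(** Each edge gives one arc per direction, so conditions that distinguish its ends can be
    counted. *)
Definition arcs (G : sgraph) (P : rel G) : nat :=
  #|[set p : G * G | adj p.1 p.2 && P p.1 p.2]|.

Lemma arcsE (G : sgraph) (P : rel G) :
  arcs P = (\sum_(p : G * G | adj p.1 p.2 && P p.1 p.2) 1)%N.
Proof. by rewrite sum1dep_card. Qed.

Lemma arcs_double (G : sgraph) (P : rel G) (Q : pred {set G}) :
  (forall u v, adj u v -> P u v = Q [set u; v]) ->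
  arcs P = (#|[set A in edges G | Q A]|).*2.
Proof.
move=> PQ; rewrite -sum1dep_card -addnn arcsE [in RHS]big_mkcondr.
rewrite -[RHS]mulr2n -(sum_arcs (fun A => if Q A then 1%N else 0%N)) big_mkcondr.
by apply: eq_bigr => p adj_p; rewrite PQ.
Qed.

Lemma arcsC (G : sgraph) (P : rel G) : arcs P = arcs (fun u v => P v u).
Proof. by rewrite !arcsE; exact: (sum_arcs_swap P (fun _ _ => 1%N)). Qed.

Lemma arcs_split (G : sgraph) (Q P : rel G) :
  arcs P = (arcs (fun u v => P u v && Q u v) +
            arcs (fun u v => P u v && ~~ Q u v))%N.
Proof.
rewrite !arcsE (bigID (fun p : G * G => Q p.1 p.2)) /=.
by congr (_ + _)%N; apply: eq_bigl => p; rewrite andbA.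
Qed.

Lemma eq_arcs (G : sgraph) (P Q : rel G) :
  (forall u v, adj u v -> P u v = Q u v) -> arcs P = arcs Q.
Proof.
by move=> PQ; apply: eq_card => p; rewrite !inE; apply: andb_id2l => /PQ.
Qed.

Lemma arcs_tail (G : sgraph) (P : pred G) :
  arcs (fun u _ => P u) = (\sum_(u | P u) deg u)%N.
Proof.
rewrite arcsE (sum_arcs_tail P (fun=> 1%N)); apply: eq_bigr => u _.
by rewrite natn.
Qed.

Lemma arcs_within (G : sgraph) (P : pred G) :
  arcs (fun u v => P u && P v) =
  (#|[set A in edges G | [forall u in A, P u]]|).*2.
Proof.
apply: (arcs_double (Q := fun A => [forall u in A, P u])) => u v _.
apply/andP/forall_inP => [[Pu Pv] x|H]; last by split; apply: H; rewrite !inE eqxx ?orbT.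
by rewrite !inE => /orP[]/eqP->.
Qed.

Lemma sum_deg (G : sgraph) : (\sum_(u : G) deg u = #|edges G|.*2)%N.
Proof.
rewrite -(arcs_tail xpredT) (eq_arcs (Q := fun u v => true && true)) //.
rewrite (arcs_within xpredT); congr _.*2; apply: eq_card => A.
by rewrite !inE andb_idr // => _; apply/forall_inP.
Qed.

(** The arcs starting at degree [i] number [i] times the vertices of that degree, an even number;
    those that stay inside the class pair up with their reverses. *)
Lemma arcs_out_even (G : sgraph) (i : nat) :
  ~~ odd i -> ~~ odd (arcs (fun u v : G => (deg u == i) && (deg v != i))).
Proof.
move=> ev_i.
have := arcs_split (fun u v : G => deg v == i) (fun u _ => deg u == i).
rewrite (arcs_within (fun u => deg u == i)) (arcs_tail (fun u => deg u == i)).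
rewrite (eq_bigr (fun=> i)) => [|u /eqP//]; rewrite sum_nat_const => E.
have : ~~ odd (#|[pred u : G | deg u == i]| * i) by rewrite oddM negb_and ev_i orbT.
by rewrite E oddD odd_double.
Qed.

(** The disjunction is symmetric in the two ends, hence a property of the edge alone, as
    [arcs_double] requires. *)
Lemma m_deg_arcs (G : sgraph) (i j : nat) :
  (m_deg G i j).*2 = arcs (fun u v : G =>
    (deg u == i) && (deg v == j) || (deg u == j) && (deg v == i)).
Proof.
apply/esym; apply: (arcs_double (Q := fun A => [exists u : G, exists v : G,
  [&& A == [set u; v], deg u == i & deg v == j]])) => u v uv; apply/esym.
have neq_uv : u != v by apply: contraTneq uv => ->; rewrite adj_irrefl.
apply/existsP/orP => [[x /existsP[y /and3P[/eqP/setP E dx dy]]]|]; last first.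
  move=> [] /andP[du dv]; [exists u; apply/existsP; exists v|exists v; apply/existsP; exists u].
    by rewrite eqxx du dv.
  by rewrite setUC eqxx du dv.
move: (E u) (E v) neq_uv; rewrite !inE !eqxx orbT /=.
move=> /esym/orP[]/eqP-> /esym/orP[]/eqP->; rewrite ?eqxx // => _.
- by left; rewrite dx dy.
- by right; rewrite dx dy.
Qed.

Lemma m_deg_diag (G : sgraph) (i : nat) :
  (m_deg G i i).*2 = arcs (fun u v : G => (deg u == i) && (deg v == i)).
Proof. by rewrite m_deg_arcs; apply: eq_arcs => u v _; rewrite orbb. Qed.

(** For [i != j] the two disjuncts exclude each other and reversal exchanges them, so each holds for
    half of the arcs. *)
Lemma m_deg_offdiag (G : sgraph) (i j : nat) : i != j ->
  m_deg G i j = arcs (fun u v : G => (deg u == i) && (deg v == j)).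
Proof.
move=> neq_ij; apply: double_inj; rewrite m_deg_arcs.
rewrite (arcs_split (fun u _ => deg u == i)) -addnn; congr (_ + _)%N; last rewrite [RHS]arcsC.
  by apply: eq_arcs => u v _; case: eqP => [->|]; rewrite ?(negPf neq_ij) ?andbF ?orbF ?andbT.
apply: eq_arcs => u v _; case: eqP => [->|]; rewrite ?(negPf neq_ij) ?andbT ?andbF //=.
by rewrite andbC.
Qed.

(** If no edge left [P], then [P] would be closed under adjacency, hence constant on a connected
    graph. *)
Lemma connected_crossing (G : sgraph) (P : pred G) (u v : G) :
  connected G -> P u -> ~~ P v -> exists x y : G, [/\ adj x y, P x & ~~ P y].
Proof.
move=> [_ conG] Pu nPv.
case: (boolP [exists x, exists y, [&& adj x y, P x & ~~ P y]]).
  by move=> /existsP[x /existsP[y /and3P[]]]; exists x, y.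
move=> /existsPn H; suff : P u = P v by rewrite Pu (negPf nPv).
have H' x y : adj x y -> P x -> P y.
  by move: (H x) => /existsPn/(_ y); rewrite !negb_and negbK => /or3P[/negPf->|/negPf->|].
apply: (@closed_connect _ (@adj G) P) (conG u v) => x y xy.
by apply/idP/idP; apply: H' => //; rewrite adj_sym.
Qed.

(** * Arc costs and the deficit of the Randić index *)

Section RandicDeficit.
Variables (R : realType) (G : sgraph).

Definition isqrt (k : nat) : R := (Num.sqrt k%:R)^-1.

Definition arc_cost (i j : nat) : R := (isqrt i - isqrt j) ^+ 2.

Definition deficit : R := \sum_(p : G * G | adj p.1 p.2) arc_cost (deg p.1) (deg p.2).

Lemma isqrt_sq k : isqrt k ^+ 2 = k%:R^-1.
Proof. by rewrite /isqrt exprVn sqr_sqrtr. Qed.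

Lemma isqrt_lt i j : (0 < i < j)%N -> isqrt j < isqrt i.
Proof.
move=> /andP[i0 ij]; have j0 : (0 < j)%N by lia.
rewrite /isqrt ltf_pV2 ?posrE ?sqrtr_gt0 ?ltr0n //.
by rewrite ltr_sqrt ?ltr0n // ltr_nat.
Qed.

Lemma isqrt_inj i j : (0 < i)%N -> (0 < j)%N -> isqrt i = isqrt j -> i = j.
Proof.
move=> i0 j0 E; case: (ltngtP i j) => // ij.
  by have := isqrt_lt (introT andP (conj i0 ij)); rewrite E ltxx.
by have := isqrt_lt (introT andP (conj j0 ij)); rewrite E ltxx.
Qed.

Lemma arc_cost_ge0 i j : 0 <= arc_cost i j.
Proof. exact: sqr_ge0. Qed.

Lemma arc_costC i j : arc_cost i j = arc_cost j i.
Proof. by rewrite /arc_cost -sqrrN opprB. Qed.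

Lemma arc_cost_eq0 i j : (0 < i)%N -> (0 < j)%N -> arc_cost i j = 0 -> i = j.
Proof.
by move=> i0 j0 /eqP; rewrite sqrf_eq0 subr_eq0 => /eqP/isqrt_inj; apply.
Qed.

Lemma arc_costii i : arc_cost i i = 0.
Proof. by rewrite /arc_cost subrr expr0n. Qed.

Lemma arc_cost_le i j k : (0 < i < j)%N -> (j <= k)%N -> arc_cost i j <= arc_cost i k.
Proof.
move=> ij; rewrite leq_eqVlt => /orP[/eqP->//|jk].
have [i0 _] := andP ij; have j0 : (0 < j < k)%N by rewrite jk andbT; lia.
have := isqrt_lt ij; have := isqrt_lt j0; rewrite /arc_cost => h1 h2.
by rewrite ler_pXn2r ?nnegrE //; lra.
Qed.

Lemma arc_cost_lt i j k : (0 < i < j)%N -> (j < k)%N -> arc_cost i j < arc_cost i k.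
Proof.
move=> ij jk.
have [i0 _] := andP ij; have j0 : (0 < j < k)%N by rewrite jk andbT; lia.
have := isqrt_lt ij; have := isqrt_lt j0; rewrite /arc_cost => h1 h2.
by rewrite ltr_pXn2r ?nnegrE //; lra.
Qed.

Lemma arc_cost_gt0 i j : (0 < i < j)%N -> 0 < arc_cost i j.
Proof. by move=> ij; rewrite exprn_gt0 // subr_gt0 isqrt_lt. Qed.

(** The squares give 1/2 + 1/3 = 5/6, and the cross term is 2 / sqrt 6. *)
Lemma arc_cost23 : arc_cost 2 3 = (5 - 2 * Num.sqrt 6) / 6 :> R.
Proof.
have E : isqrt 2 * isqrt 3 = Num.sqrt 6 / 6.
  rewrite /isqrt -invfM -sqrtrM ?ler0n // -natrM /=.
  have s6 : Num.sqrt (6 : R) != 0 by rewrite gt_eqF // sqrtr_gt0 ltr0n.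
  apply: (mulfI s6); rewrite mulfV // mulrA -expr2 sqr_sqrtr ?ler0n // mulfV //.
  by rewrite pnatr_eq0.
by rewrite /arc_cost sqrrB !isqrt_sq E; field.
Qed.

(** Lets the two arcs of a single edge at a degree-1 vertex exceed the whole minimal deficit. *)
Lemma arc_cost12_gt : 2 * arc_cost 2 3 < arc_cost 1 2.
Proof.
have i1 : isqrt 1 = 1 by rewrite /isqrt sqrtr1 invr1.
have p2 : 0 < isqrt 2 by rewrite invr_gt0 sqrtr_gt0 ltr0n.
have p3 : 0 < isqrt 3 by rewrite invr_gt0 sqrtr_gt0 ltr0n.
have E2 : isqrt 2 ^+ 2 = 1 / 2 by rewrite isqrt_sq div1r.
have E3 : isqrt 3 ^+ 2 = 1 / 3 by rewrite isqrt_sq div1r.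
have lt32 : isqrt 3 < isqrt 2 by exact: isqrt_lt.
rewrite /arc_cost i1; set a := isqrt 2 in p2 E2 lt32 *; set b := isqrt 3 in p3 E3 lt32 *.
(* [hab] says 2(a - b) < 1 - a, whose square is even stronger than the goal. Squaring [hab] itself
   turns it into 9/2 < 7/3 + 4b, that is b > 13/24. *)
have hb : 13 / 24 < b by nra.
have hab : 3 * a < 1 + 2 * b by nra.
nra.
Qed.

Hypothesis deg_gt0 : forall u : G, (0 < deg u)%N.

(** Expand the squares: the [deg u] arcs from [u] contribute 1 in total, so tails and heads give n
    each, while the cross terms give 4 R(G). *)
Lemma randicE : 2 * randic R G = #|vertex G|%:R - deficit / 2.
Proof.
have E1 : 2 * randic R G = \sum_(p : G * G | adj p.1 p.2) isqrt (deg p.1) * isqrt (deg p.2).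
  rewrite /randic mulr_natl -sum_arcs; apply: eq_bigr => -[u v] /= uv.
  have neq_uv : u != v by apply: contraTneq uv => ->; rewrite adj_irrefl.
  by rewrite big_setU1 ?inE //= big_set1 sqrtrM ?ler0n // invfM mul1r.
have E2 : \sum_(p : G * G | adj p.1 p.2) isqrt (deg p.1) ^+ 2 = #|vertex G|%:R.
  rewrite (eq_bigl (fun p : G * G => adj p.1 p.2 && true)) => [|p]; last by rewrite andbT.
  rewrite (sum_arcs_tail xpredT (fun u => isqrt (deg u) ^+ 2)) /=.
  rewrite (eq_bigr (fun=> 1)) => [|u _]; first by rewrite sumr_const.
  by rewrite isqrt_sq -[LHS]mulr_natr mulVf // pnatr_eq0 -lt0n.
have E3 : \sum_(p : G * G | adj p.1 p.2) isqrt (deg p.2) ^+ 2 = #|vertex G|%:R.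
  rewrite -E2 (eq_bigl (fun p : G * G => adj p.1 p.2 && true)) => [|p]; last by rewrite andbT.
  rewrite (sum_arcs_swap (fun _ _ => true) (fun _ v => isqrt (deg v) ^+ 2)) /=.
  by apply: eq_bigl => p; rewrite andbT.
have -> : deficit = \sum_(p : G * G | adj p.1 p.2) isqrt (deg p.1) ^+ 2
   + \sum_(p : G * G | adj p.1 p.2) isqrt (deg p.2) ^+ 2
   - 2 * \sum_(p : G * G | adj p.1 p.2) isqrt (deg p.1) * isqrt (deg p.2).
  rewrite mulr_sumr -big_split -sumrB /=; apply: eq_bigr => p _.
  by rewrite /arc_cost; ring.
by rewrite E1 E2 E3; field.
Qed.

(* The arcs between vertices of degree 2 cost nothing; those with exactly one
   end of degree 2 come in opposite pairs. *)
Lemma deficit_split :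
  deficit = 2 * \sum_(p : G * G | adj p.1 p.2 && ((deg p.1 == 2%N) && (deg p.2 != 2%N)))
                  arc_cost (deg p.1) (deg p.2)
    + \sum_(p : G * G | adj p.1 p.2 && ((deg p.1 != 2%N) && (deg p.2 != 2%N)))
                  arc_cost (deg p.1) (deg p.2).
Proof.
rewrite /deficit (bigID (fun p => deg p.1 == 2%N)) /=.
rewrite (bigID (fun p => deg p.2 == 2%N)) /= big1 ?add0r; last first.
  by move=> p /andP[/andP[_ /eqP->] /eqP->]; rewrite arc_costii.
rewrite [X in _ + X](bigID (fun p => deg p.2 == 2%N)) /= mulr2n mulrDl mul1r -addrA.
congr (_ + (_ + _)); try by apply: eq_bigl => p; rewrite andbA.
rewrite (sum_arcs_swap (fun u v => (deg u == 2%N) && (deg v != 2%N))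
           (fun u v => arc_cost (deg u) (deg v))) /=.
apply: eq_big => [p|p _]; last exact: arc_costC.
by rewrite -andbA [X in _ && X]andbC.
Qed.

End RandicDeficit.

(** * Counting in graphs whose degrees are 2 and 3 *)

Lemma m_deg_out23 (G : sgraph) : (forall u : G, (deg u == 2%N) || (deg u == 3%N)) ->
  arcs (fun u v : G => (deg u == 2%N) && (deg v != 2%N)) = m_deg G 2 3.
Proof.
move=> deg23; rewrite m_deg_offdiag //; apply: eq_arcs => u v _.
by congr (_ && _); have /orP[/eqP->|/eqP->] := deg23 v.
Qed.

Lemma n_deg_arcs (G : sgraph) (i : nat) :
  (n_deg G i * i = arcs (fun u v : G => (deg u == i) && (deg v == i)) +
     arcs (fun u v : G => (deg u == i) && (deg v != i)))%N.
Proof.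
rewrite -(arcs_split (fun _ v => deg v == i) (fun u _ => deg u == i)).
rewrite (arcs_tail (fun u => deg u == i)) (eq_bigr (fun=> i)) => [|u /eqP//].
by rewrite sum_nat_const /n_deg cardsE.
Qed.

(** The two degree classes are disjoint, so they cover all vertices exactly when their sizes add up
    to n. *)
Lemma n_deg23 (G : sgraph) :
  (n_deg G 2 + n_deg G 3)%N = #|vertex G| <-> forall u : G, (deg u == 2%N) || (deg u == 3%N).
Proof.
have <- : #|[set u : G | (deg u == 2%N) || (deg u == 3%N)]| = (n_deg G 2 + n_deg G 3)%N.
  rewrite /n_deg -cardsUI [X in (_ + X)%N]eq_card0 ?addn0 => [|u].
    by apply: eq_card => u; rewrite !inE.
  by rewrite !inE; case: eqP => [->|].
split=> [E u|deg23]; last by apply: eq_card => u; rewrite inE deg23.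
have /eqP/setP/(_ u) : [set u : G | (deg u == 2%N) || (deg u == 3%N)] == setT.
  by rewrite eqEcard subsetT cardsT E leqnn.
by rewrite !inE.
Qed.

(** From n_2 + n_3 = n and 2 n_2 + 3 n_3 = 2(n + c - 1) follows n_3 = 2c - 2; then i n_i = 2 m_{i,i}
    + 2 for i = 2, 3 gives the edge counts. *)
Lemma subcubic_counts (G : sgraph) (c : nat) : (2 <= c)%N ->
  has_cyclomatic_number G c ->
  (forall u : G, (deg u == 2%N) || (deg u == 3%N)) ->
  arcs (fun u v : G => (deg u == 2%N) && (deg v != 2%N)) = 2%N ->
  [/\ n_deg G 3 = 2 * c - 2, n_deg G 2 + (2 * c - 2) = #|vertex G|,
      m_deg G 3 3 = 3 * c - 4, m_deg G 2 3 = 2 &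
      m_deg G 2 2 + (2 * c - 1) = #|vertex G|]%N.
Proof.
move=> c2 [[n0 _] En] deg23 out2.
have E23 := (n_deg23 G).2 deg23.
have out3 : arcs (fun u v : G => (deg u == 3%N) && (deg v != 3%N)) = 2%N.
  apply: etrans out2; rewrite arcsC; apply: eq_arcs => u v _.
  by have /orP[/eqP->|/eqP->] := deg23 v; have /orP[/eqP->|/eqP->] := deg23 u.
have := n_deg_arcs G 2; have := n_deg_arcs G 3.
rewrite -!m_deg_diag out2 out3 => F3 F2.
have Es : (\sum_(u : G) deg u = n_deg G 2 * 2 + n_deg G 3 * 3)%N.
  rewrite (bigID (fun u => deg u == 2%N)) /= (eq_bigr (fun=> 2%N)) => [|u /eqP//].
  rewrite [X in (_ + X)%N](eq_bigr (fun=> 3%N)) => [|u]; last first.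
    by have /orP[/eqP->|/eqP->] := deg23 u.
  rewrite !sum_nat_const /n_deg !cardsE; congr (_ + _ * _)%N.
  by apply: eq_card => u; rewrite !unfold_in /=; have /orP[/eqP->|/eqP->] := deg23 u.
have := sum_deg G; rewrite Es En -(m_deg_out23 deg23) out2.
by split; lia.
Qed.

(** * The minimum of the deficit and the graphs attaining it *)

Section MinimalDeficit.
Variables (R : realType) (G : sgraph) (c : nat).
Hypotheses (c_ge2 : (2 <= c)%N) (cycG : has_cyclomatic_number G c).
Hypothesis big_G : (2 * c - 2 < #|vertex G|)%N.

Let conG : connected G := cycG.1.

(** Otherwise the degree sum 2(n + c - 1) would be at most 2n, against c >= 2. *)
Lemma exists_deg_ge3 : exists u : G, (3 <= deg u)%N.
Proof.
apply/existsP; apply: contraT => /existsPn H.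
have : (\sum_(u : G) deg u <= \sum_(u : G) 2)%N.
  by apply: leq_sum => u _; move: (H u); rewrite -ltnNge.
have [[n0 _] En] := cycG; rewrite sum_deg En sum_nat_const => le.
have : ((#|vertex G| + c - 1).*2 <= #|vertex G| * 2)%N := le.
by lia.
Qed.

(** Otherwise 3n <= 2(n + c - 1), that is n <= 2c - 2, against [big_G]. *)
Lemma exists_deg_le2 : exists u : G, (deg u <= 2)%N.
Proof.
apply/existsP; apply: contraT => /existsPn H.
have : (\sum_(u : G) 3 <= \sum_(u : G) deg u)%N.
  by apply: leq_sum => u _; move: (H u); rewrite -ltnNge.
have [[n0 _] En] := cycG; rewrite sum_deg En sum_nat_const => le.
have : (#|vertex G| * 3 <= (#|vertex G| + c - 1).*2)%N := le.
by lia.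
Qed.

Lemma connected_deg_gt0 (u : G) : (0 < deg u)%N.
Proof.
rewrite lt0n; apply/negP => du0; have [v dv] := exists_deg_ge3.
have ndv : ~~ (deg v == 0%N) by rewrite -lt0n (ltn_trans _ dv).
have [x [y [xy dx _]]] :=
  connected_crossing (P := fun u => deg u == 0%N) conG du0 ndv.
by move: dx; rewrite cards_eq0 => /eqP/setP/(_ y); rewrite !inE xy.
Qed.

Lemma deficit_deg1 (u : G) : deg u = 1%N -> 4 * arc_cost R 2 3 < deficit R G.
Proof.
move=> du; have [v dv] := exists_deg_ge3.
have ndv : ~~ (deg v == 1%N) by rewrite neq_ltn (ltn_trans _ dv) ?orbT.
have [x [y [xy /eqP dx ndy]]] :=
  connected_crossing (P := fun u => deg u == 1%N) conG (introT eqP du) ndv.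
have dy : (2 <= deg y)%N by have := connected_deg_gt0 y; lia.
have neq_xy : x != y by apply: contraTneq xy => ->; rewrite adj_irrefl.
(* Both arcs of the crossing edge are isolated; the remaining costs are nonnegative. *)
rewrite /deficit (bigD1 (x, y)) //= (bigD1 (y, x)) /=; last first.
  by rewrite adj_sym xy xpair_eqE negb_and eq_sym neq_xy.
rewrite (arc_costC _ (deg y)) dx.
have := arc_cost12_gt R.
have : arc_cost R 1 2 <= arc_cost R 1 (deg y) by exact: arc_cost_le.
set S := \sum_(_ | _) _; have : 0 <= S by apply: sumr_ge0 => *; exact: arc_cost_ge0.
by set a := arc_cost R 1 2; set b := arc_cost R 2 3; set d := arc_cost R 1 _; lra.
Qed.

Lemma out2_ge2 : (forall u : G, (2 <= deg u)%N) ->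
  (2 <= arcs (fun u v : G => (deg u == 2%N) && (deg v != 2%N)))%N.
Proof.
move=> deg2; have [u du] := exists_deg_le2; have [v dv] := exists_deg_ge3.
have du2 : deg u == 2%N by rewrite eqn_leq du deg2.
have ndv : ~~ (deg v == 2%N) by rewrite neq_ltn dv orbT.
have [x [y [xy dx dy]]] := connected_crossing (P := fun u => deg u == 2%N) conG du2 ndv.
have : (0 < arcs (fun u v : G => (deg u == 2%N) && (deg v != 2%N)))%N.
  by apply/card_gt0P; exists (x, y); rewrite inE /= xy dx dy.
by have := @arcs_out_even G 2 isT; lia.
Qed.

(** When all degrees are at least 2, each of the three terms is nonnegative, so equality makes each
    vanish. *)
Lemma deficit_excess :
  deficit R G - 4 * arc_cost R 2 3 =
  2 * \sum_(p : G * G | adj p.1 p.2 && ((deg p.1 == 2%N) && (deg p.2 != 2%N)))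
        (arc_cost R (deg p.1) (deg p.2) - arc_cost R 2 3)
  + 2 * arc_cost R 2 3 *
      ((arcs (fun u v : G => (deg u == 2%N) && (deg v != 2%N)))%:R - 2)
  + \sum_(p : G * G | adj p.1 p.2 && ((deg p.1 != 2%N) && (deg p.2 != 2%N)))
        arc_cost R (deg p.1) (deg p.2).
Proof.
rewrite deficit_split sumrB sumr_const /arcs cardsE -[arc_cost R 2 3 *+ _]mulr_natr.
by ring.
Qed.

Lemma deficit_min :
  4 * arc_cost R 2 3 <= deficit R G /\
  (deficit R G = 4 * arc_cost R 2 3 <->
   (forall u : G, (deg u == 2%N) || (deg u == 3%N)) /\
   arcs (fun u v : G => (deg u == 2%N) && (deg v != 2%N)) = 2%N).
Proof.
case: (boolP [exists u : G, deg u == 1%N]) => [/existsP[u0 /eqP du0]|/existsPn deg1].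
  have lt := deficit_deg1 du0; split; first exact: ltW.
  split=> [E|[/(_ u0)]]; first by rewrite E ltxx in lt.
  by rewrite du0.
have deg2 (u : G) : (2 <= deg u)%N.
  by have := connected_deg_gt0 u; have := deg1 u; lia.
have w0 : 0 < arc_cost R 2 3 by exact: arc_cost_gt0.
have out_ge (p : G * G) : adj p.1 p.2 && ((deg p.1 == 2%N) && (deg p.2 != 2%N)) ->
    0 <= arc_cost R (deg p.1) (deg p.2) - arc_cost R 2 3.
  move=> /and3P[_ /eqP-> n2]; rewrite subr_ge0 arc_cost_le //.
  by have := deg2 p.2; lia.
have x2 := out2_ge2 deg2.
have := deficit_excess; set S := \sum_(_ | _) _; set T := \sum_(_ | _) _; set x := arcs _ in x2 *.
have S0 : 0 <= S by exact: sumr_ge0.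
have T0 : 0 <= T by apply: sumr_ge0 => *; exact: arc_cost_ge0.
have X0 : 0 <= 2 * arc_cost R 2 3 * (x%:R - 2).
  by rewrite mulr_ge0 ?subr_ge0 ?(ler_nat _ 2) // mulr_ge0 // ltW.
set X := 2 * _ * _ in X0 *; set w := arc_cost R 2 3 in w0 *; move=> E.
split; first by lra.
split=> [E0|[deg23 Ex]]; last first.
  suff : S = 0 /\ T = 0 by rewrite /X Ex subrr mulr0 in E *; move=> [ES ET]; lra.
  split; apply: big1 => p.
    move=> /and3P[_ /eqP-> n2]; have := deg23 p.2; rewrite (negPf n2) => /eqP->.
    by rewrite subrr.
  move=> /and3P[_ n1 n2]; have := deg23 p.1; have := deg23 p.2.
  by rewrite (negPf n1) (negPf n2) => /eqP-> /eqP->; rewrite arc_costii.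
have ES : S = 0 by lra.
have ET : T = 0 by lra.
have /eqP EX : X = 0 by lra.
split; last first.
  move: EX; rewrite mulf_eq0 mulf_eq0 (gt_eqF w0) pnatr_eq0 /= subr_eq0.
  by rewrite (eqr_nat _ _ 2) => /eqP.
(* As [S = 0], each arc out of degree 2 costs exactly [w]; a head of degree above 3 would cost
   more. *)
have out3 (u v : G) : adj u v -> deg u = 2%N -> deg v != 2%N -> deg v = 3%N.
  move=> uv du dv.
  have /= := psumr_eq0P out_ge ES (i := (u, v)); rewrite uv du dv => /(_ isT) Euv.
  apply/eqP; rewrite eqn_leq; apply/andP; split; last by have := deg2 v; lia.
  rewrite leqNgt; apply/negP => dv3.
  have : w < arc_cost R 2 (deg v) by exact: arc_cost_lt.
  by rewrite -subr_gt0 /w Euv ltxx.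
have same (u v : G) : adj u v -> deg u != 2%N -> deg v != 2%N -> deg u = deg v.
  move=> uv du dv; apply: (@arc_cost_eq0 R); rewrite ?connected_deg_gt0 //.
  have := psumr_eq0P (fun p _ => arc_cost_ge0 R (deg p.1) (deg p.2)) ET (i := (u, v)).
  by rewrite /= uv du dv; apply.
have [u du] := exists_deg_le2.
have Pu : (deg u == 2%N) || (deg u == 3%N) by rewrite eqn_leq du deg2.
move=> v; apply: contraT => Pv.
(* An edge from degrees 2 or 3 to another degree contradicts [out3] or [same], according to the
   degree of [x']. *)
have [x' [y [xy Px Py]]] :=
  connected_crossing (P := fun u => (deg u == 2%N) || (deg u == 3%N)) conG Pu Pv.
move: Py; rewrite negb_or => /andP[ny2 ny3]; exfalso.
case: (eqVneq (deg x') 2) Px => [dx _|nx2 /= /eqP dx].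
  by rewrite (out3 _ _ xy dx ny2) in ny3.
by rewrite -(same _ _ xy nx2 ny2) dx in ny3.
Qed.

(** By [randicE], a deficit of at least 4w means R(G) <= n/2 - w. *)
Lemma randic_max :
  let b := 1 / 2 * #|vertex G|%:R - (5 - 2 * Num.sqrt 6) / 6 in
  randic R G <= b /\
  (randic R G = b <->
   [/\ n_deg G 3 = 2 * c - 2, n_deg G 2 + (2 * c - 2) = #|vertex G|,
       m_deg G 3 3 = 3 * c - 4, m_deg G 2 3 = 2 &
       m_deg G 2 2 + (2 * c - 1) = #|vertex G|]%N).
Proof.
rewrite -arc_cost23 /=; have [le eq] := deficit_min.
have E := randicE R connected_deg_gt0.
split; first by lra.
split=> [Eb|[E3 E2 _ E23 _]].
  have /eq[deg23 out2] : deficit R G = 4 * arc_cost R 2 3 by lra.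
  exact: subcubic_counts.
have deg23 : forall u : G, (deg u == 2%N) || (deg u == 3%N).
  by apply/n_deg23; rewrite E3.
have : deficit R G = 4 * arc_cost R 2 3 by apply/eq; rewrite m_deg_out23.
by lra.
Qed.

End MinimalDeficit.

Theorem theorem2p6 (R : realType) :
  (forall (n : nat) (G : sgraph),
     (9 <= n)%N -> #|vertex G| = n -> connected G ->
     has_cyclomatic_number G 5 ->
     randic R G <= 1 / 2 * n%:R - (5 - 2 * Num.sqrt 6) / 6 /\
     (randic R G = 1 / 2 * n%:R - (5 - 2 * Num.sqrt 6) / 6 <->
      G \in Omega1 n)) /\
  (forall (n : nat) (G : sgraph),
     (11 <= n)%N -> #|vertex G| = n -> connected G ->
     has_cyclomatic_number G 6 ->
     randic R G <= 1 / 2 * n%:R - (5 - 2 * Num.sqrt 6) / 6 /\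
     (randic R G = 1 / 2 * n%:R - (5 - 2 * Num.sqrt 6) / 6 <->
      G \in Omega3 n)).
Proof.
split=> n G n_ge nE conG cycG; subst n.
  (* For c = 5 the values 2c - 2, 3c - 4, 2c - 1 are 8, 11, 9, and [big_G] reads n >= 9. *)
  have [le eq] := randic_max R (c := 5) isT cycG n_ge.
  split=> //; apply: (iff_trans eq); rewrite inE eqxx /=; split.
    by move=> [-> -> -> -> ->]; rewrite !eqxx.
  by move=> /and5P[/eqP-> /eqP-> /eqP-> /eqP-> /eqP->].
(* For c = 6 they are 10, 14, 11, and [big_G] reads n >= 11. *)
have [le eq] := randic_max R (c := 6) isT cycG n_ge.
split=> //; apply: (iff_trans eq); rewrite inE eqxx /=; split.
  by move=> [-> -> -> -> ->]; rewrite !eqxx.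
by move=> /and5P[/eqP-> /eqP-> /eqP-> /eqP-> /eqP->].
Qed.
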